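(* Let $f:\mathbb{Z}\to\mathbb{R}$ be a function in $\ell^1(\mathbb{Z})$. Then $$\mathrm{Var}(Mf)\le\Big(2+\frac{146}{315}\Big)\|f\|_{\ell^1(\mathbb{Z})}.$$
   Context: Let $\mathbb{Z}^+=\{0,1,2,\dots\}$. For $f:\mathbb{Z}\to\mathbb{R}$, the discrete centered Hardy–Littlewood maximal operator is $$Mf(n)=\sup_{r\in\mathbb{Z}^+}\frac{1}{2r+1}\sum_{k=-r}^{r}|f(n+k)|,\qquad n\in\mathbb{Z}.$$ The total variation of $g:\mathbb{Z}\to\mathbb{R}$ is $\mathrm{Var}(g)=\sum_{n=-\infty}^{\infty}|g(n+1)-g(n)|$, and $\|f\|_{\ell^1(\mathbb{Z})}=\sum_{n\in\mathbb{Z}}|f(n)|$. *)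

(* Defs.v *)
From HB Require Import structures.
From mathcomp Require Import all_boot all_order all_algebra.
From mathcomp Require Import all_classical all_reals all_analysis.
Set Implicit Arguments. Unset Strict Implicit. Unset Printing Implicit Defensive.
Import Order.TTheory GRing.Theory Num.Theory.
Local Open Scope classical_set_scope.
Local Open Scope ring_scope.

Definition cavg (R : realType) (f : int -> R) (n : int) (r : nat) : R :=
  ((2 * r + 1)%:R)^-1 * \sum_(k < (2 * r).+1) `|f (n - r%:Z + k%:Z)|.

(* discrete centered Hardy-Littlewood maximal function (real sup; the set of
   averages is bounded for f in l^1) *)
Definition maxf (R : realType) (f : int -> R) (n : int) : R :=
  sup [set cavg f n r | r in [set: nat]].

Definition l1norm (R : realType) (f : int -> R) : \bar R :=
  (\esum_(n in [set: int]) (`|f n|)%:E)%E.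

Definition in_l1 (R : realType) (f : int -> R) : Prop :=
  (l1norm f < +oo)%E.

Definition totvar (R : realType) (g : int -> R) : \bar R :=
  (\esum_(n in [set: int]) (`|g (n + 1) - g n|)%:E)%E.

(* Main.v *)
Require Import Defs.
From mathcomp Require Import all_boot all_order all_algebra.
From mathcomp Require Import all_classical all_reals all_analysis.
From mathcomp Require Import zify ring.
Set Implicit Arguments.
Unset Strict Implicit.
Unset Printing Implicit Defensive.
Import Order.TTheory GRing.Theory Num.Theory.
Local Open Scope classical_set_scope.
Local Open Scope ring_scope.

(** Write [Mf(n)] as the supremum over [r] of [w r * \sum_(|m - n| <= r) |f m|]
    with [w r = 1/(2r+1)].  If [p] and [q] are neighbours, the window of radius
    [r] at [p] lies in the one of radius [r+1] at [q], so that [Mf(p) - Mf(q)]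
    is at most the supremum over [r] of
    [(w r - w (r+1)) * \sum_(|m - p| <= r) |f m|].  As [w] is convex, the weight
    of each [|f m|] only increases if [r] is replaced by [|m - p|], hence
    [|Mf(n+1) - Mf(n)| <= \sum_m |f m| * k (n - m)], where
    [k t = k (-t-1) = w t - w (t+1)] for [t >= 0].  Summing over [n], the
    variation is at most [||f||_1 * \sum_z k z], and [\sum_z k z] telescopes to
    at most [2 * w 0 = 2]. *)

Lemma ler_sum_subset (R : numDomainType) (I : eqType) (s t : seq I)
    (F : I -> R) : (forall i, 0 <= F i) -> uniq s -> {subset s <= t} ->
  \sum_(i <- s) F i <= \sum_(i <- t) F i.
Proof.
move=> F0 s_uniq st.
have /count_subseqP[s' /perm_to_subseq[r t_perm] s_perm] :
    forall i, (count_mem i s <= count_mem i t)%N by exact: leq_uniq_count.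
by rewrite (perm_big _ s_perm) (perm_big _ t_perm) big_cat lerDl sumr_ge0.
Qed.

Section esum_facts.
Variable R : realType.
Local Open Scope ereal_scope.

Lemma sum_le_esum (T : choiceType) (D : set T) (s : seq T) (a : T -> \bar R) :
  uniq s -> [set` s] `<=` D -> \sum_(i <- s) a i <= \esum_(i in D) a i.
Proof.
move=> s_uniq sD; apply: esum_ge; exists [set` s]; last by rewrite fsbig_seq.
by split=> //; exact: finite_seq.
Qed.

Lemma ge0_esumZl (T : choiceType) (D : set T) (x : \bar R) (a : T -> \bar R) :
  0 <= x -> (forall i, 0 <= a i) ->
  \esum_(i in D) (x * a i) = x * \esum_(i in D) a i.
Proof.
move=> + a0; case: x => [r|_|//].
  rewrite lee_fin => r0; rewrite /esum -ereal_supZl//; last first.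
    by apply/set0P; eexists; exists set0; first exact: fsets_set0.
  rewrite [in RHS]image_comp; congr ereal_sup; apply: eq_imagel => A _ /=.
  by rewrite ge0_mule_fsumr.
have [[i Di ai]|nai] := pselect (exists2 i, D i & 0 < a i).
  have single_le (b : T -> \bar R) : b i <= \esum_(j in D) b j.
    rewrite -[leLHS](big_seq1 +%E i b) sum_le_esum// => j.
    by rewrite /= inE => /eqP ->.
  rewrite gt0_mulye ?(lt_le_trans ai) ?single_le//; apply/eqP.
  by rewrite eq_le leey -[leLHS](gt0_mulye ai) single_le.
have aE i : D i -> a i = 0.
  move=> Di; apply/eqP; rewrite eq_le a0 andbT leNgt; apply/negP => ai.
  by apply: nai; exists i.
by rewrite [X in _ * X]esum1// mule0 esum1// => i /aE ->; rewrite mule0.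
Qed.

Lemma exchange_esum (S T : choiceType) (I : set S) (J : set T)
    (a : S -> T -> \bar R) :
  (forall i j, I i -> J j -> 0 <= a i j) ->
  \esum_(i in I) \esum_(j in J) a i j = \esum_(j in J) \esum_(i in I) a i j.
Proof.
move=> a0; rewrite !esum_esum//; last by move=> j i Jj Ii; exact: a0.
rewrite (reindex_esum (J `*` I) _ (fun x => (x.2, x.1)))//; split=> //=.
- by move=> [i j] [].
- by move=> [i j] [i' j'] _ _ [-> ->].
- by move=> [i j] [Ii Jj]; exists (j, i).
Qed.

Lemma esum_convolution (V : zmodType) (F K : V -> \bar R) :
  (forall x, 0 <= F x) -> (forall x, 0 <= K x) ->
  \esum_(x in setT) \esum_(y in setT) (F y * K (x - y)%R) =
  (\esum_(y in setT) F y) * \esum_(x in setT) K x.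
Proof.
move=> F0 K0; rewrite exchange_esum; last by move=> x y _ _; rewrite mule_ge0.
rewrite muleC -ge0_esumZl ?esum_ge0//; apply: eq_esum => y _.
rewrite ge0_esumZl// muleC; congr (_ * _).
rewrite [RHS](reindex_esum setT _ (fun x => x - y)%R)//; split=> //.
  by move=> x x' _ _ /addIr.
by move=> x _; exists (x + y)%R; rewrite ?addrK.
Qed.

Lemma esum_int (a : int -> \bar R) : (forall z, 0 <= a z) ->
  \esum_(z in setT) a z =
  (\esum_(t in setT) a (Posz t)) + \esum_(t in setT) a (Negz t).
Proof.
move=> a0; rewrite (esumID (range Posz))// !setTI; congr (_ + _).
  by rewrite esum_image// => t t' _ _ [].
rewrite (_ : ~` range Posz = range Negz) ?esum_image//.
  by move=> t t' _ _ [].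
apply/seteqP; split=> [[t|t] /= z|_ [t _ <-] [t' _ //]]; last by exists t.
by case: z; exists t.
Qed.

Lemma esum_telescope_le (u : R^nat) : (forall t, 0 <= u t)%R ->
  nonincreasing_seq u -> \esum_(t in setT) (u t - u t.+1)%:E <= (u 0%N)%:E.
Proof.
move=> u0 u_dec; have drop0 t : 0 <= (u t - u t.+1)%:E.
  by rewrite lee_fin subr_ge0 u_dec.
rewrite -nneseries_esumT//; apply: lime_le; first exact: is_cvg_nneseries.
apply: nearW => N; rewrite sumEFin lee_fin.
under eq_bigr do rewrite -opprB.
by rewrite sumrN telescope_sumr// opprB lerBlDr lerDl.
Qed.

End esum_facts.

Definition window (n : int) (r : nat) : seq int :=
  [seq n - r%:Z + k%:Z | k <- iota 0 (2 * r).+1].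

Lemma window_uniq n r : uniq (window n r).
Proof. by rewrite map_inj_uniq ?iota_uniq// => j k; lia. Qed.

Lemma mem_window n r m : (m \in window n r) = (`|m - n| <= r)%N.
Proof.
apply/mapP/idP => [[k] + ->|mr]; rewrite ?mem_iota; first by lia.
by exists (absz (m - n + r%:Z)); rewrite ?mem_iota; lia.
Qed.

Lemma sub_window p q r s : (`|p - q| + r <= s)%N ->
  {subset window p r <= window q s}.
Proof. by move=> pqrs m; rewrite !mem_window; lia. Qed.

Section weighted_maximal_function.
Variables (R : realType) (w : R^nat) (f : int -> R).

Definition weighted_avg (n : int) (r : nat) : R :=
  w r * \sum_(m <- window n r) `|f m|.

Definition weighted_max (n : int) : R := sup (range (weighted_avg n)).

Definition weight_drop (r : nat) : R := w r - w r.+1.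

Definition step_kernel (z : int) : R :=
  match z with Posz t | Negz t => weight_drop t end.

Hypothesis w_ge0 : forall r, 0 <= w r.
Hypothesis w_nonincreasing : nonincreasing_seq w.
Hypothesis w_convex : nonincreasing_seq weight_drop.
Hypothesis f_l1 : in_l1 f.

Let absf_ge0 (m : int) : (0 <= `|f m|%:E)%E.
Proof. by rewrite lee_fin. Qed.

Lemma step_kernel_ge0 z : 0 <= step_kernel z.
Proof. by case: z => t; rewrite subr_ge0 w_nonincreasing. Qed.

Lemma esum_step_kernel_le :
  (\esum_(z in setT) (step_kernel z)%:E <= (2 * w 0%N)%:E)%E.
Proof.
rewrite esum_int => [|z]; last by rewrite lee_fin step_kernel_ge0.
by rewrite mulr_natl mulr2n EFinD leeD// esum_telescope_le.
Qed.

Lemma weight_drop_le_step_kernel n p m r : p \in [:: n; n + 1] ->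
  m \in window p r -> weight_drop r <= step_kernel (n - m).
Proof.
rewrite mem_window !inE => p_n m_p.
by case E: (n - m) => [t|t] /=; apply: w_convex; lia.
Qed.

Lemma has_ubound_weighted_avg n : has_ubound (range (weighted_avg n)).
Proof.
have l1_fin : l1norm f \is a fin_num by rewrite ge0_fin_numE ?esum_ge0.
exists (w 0%N * fine (l1norm f)) => _ [r _ <-].
apply: ler_pM => //; [exact: sumr_ge0|exact: w_nonincreasing|].
by rewrite -lee_fin fineK// -sumEFin sum_le_esum ?window_uniq.
Qed.

Lemma weighted_avg_le_max n r : weighted_avg n r <= weighted_max n.
Proof. by apply: ub_le_sup; [exact: has_ubound_weighted_avg|exists r]. Qed.

Lemma weighted_avgB_le p q r : (`|p - q| <= 1)%N ->
  weighted_avg p r - weighted_avg q r.+1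
  <= \sum_(m <- window p r) `|f m| * weight_drop r.
Proof.
move=> pq; rewrite -mulr_suml mulrC mulrBl lerB// ler_wpM2l//.
by apply: ler_sum_subset; [|exact: window_uniq|apply: sub_window; lia].
Qed.

Lemma weighted_maxB_le n p q : p \in [:: n; n + 1] -> q \in [:: n; n + 1] ->
  ((weighted_max p - weighted_max q)%:E
   <= \esum_(m in setT) (`|f m|%:E * (step_kernel (n - m))%:E))%E.
Proof.
move=> p_n q_n; rewrite EFinB leeBlDr// -ereal_sup_EFin; last first.
- by exists (weighted_avg p 0%N), 0%N.
- exact: has_ubound_weighted_avg.
apply: ge_ereal_sup => _ [_ [r _ <-] <-]; rewrite -leeBlDr// -EFinB.
apply: le_trans (sum_le_esum _ (window_uniq p r) (@subsetT _ _)).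
under eq_bigr do rewrite -EFinM.
rewrite sumEFin lee_fin.
apply: le_trans (lerB (lexx _) (weighted_avg_le_max q r.+1)) _.
have pq : (`|p - q| <= 1)%N by move: p_n q_n; rewrite !inE; lia.
apply: le_trans (weighted_avgB_le r pq) _.
rewrite big_seq [leRHS]big_seq; apply: ler_sum => m m_p.
by rewrite ler_wpM2l// (weight_drop_le_step_kernel p_n).
Qed.

Lemma weighted_max_step_le n :
  (`|weighted_max (n + 1) - weighted_max n|%:E
   <= \esum_(m in setT) (`|f m|%:E * (step_kernel (n - m))%:E))%E.
Proof.
by case: ger0P => _; rewrite ?opprB; apply: weighted_maxB_le;
  rewrite !inE eqxx ?orbT.
Qed.

Lemma totvar_weighted_max_le :
  (totvar weighted_max <= (2 * w 0%N)%:E * l1norm f)%E.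
Proof.
rewrite muleC; apply: le_trans (le_esum (fun n _ => weighted_max_step_le n)) _.
rewrite (@esum_convolution _ _ (fun m => `|f m|%:E) (EFin \o step_kernel))//=.
  by rewrite lee_wpmul2l ?esum_ge0 ?esum_step_kernel_le.
by move=> z; rewrite lee_fin step_kernel_ge0.
Qed.

End weighted_maximal_function.

Section centered_averages.
Variable R : realType.

Definition inv_odd (r : nat) : R := ((2 * r + 1)%:R)^-1.

Lemma inv_odd_ge0 r : 0 <= inv_odd r.
Proof. by rewrite invr_ge0. Qed.

Lemma inv_odd_nonincreasing : nonincreasing_seq inv_odd.
Proof. by move=> r s rs; rewrite lef_pV2 ?posrE ?ltr0n ?ler_nat; lia. Qed.

Lemma weight_drop_inv_odd r :
  weight_drop inv_odd r = 2 * (inv_odd r * inv_odd r.+1).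
Proof.
rewrite /weight_drop /inv_odd.
by field; rewrite nat1r -!natrM !natr1 !pnatr_eq0.
Qed.

Lemma inv_odd_convex : nonincreasing_seq (weight_drop inv_odd).
Proof.
move=> r s rs; rewrite !weight_drop_inv_odd ler_wpM2l//.
by rewrite ler_pM ?inv_odd_ge0 ?inv_odd_nonincreasing.
Qed.

Lemma cavgE (f : int -> R) : cavg f = weighted_avg inv_odd f.
Proof.
apply/funext => n; apply/funext => r; rewrite /cavg /weighted_avg big_map.
have := big_mkord xpredT (fun k => `|f (n - r%:Z + k%:Z)|).
by rewrite /index_iota => <-; rewrite subn0.
Qed.

Lemma maxfE (f : int -> R) : maxf f = weighted_max inv_odd f.
Proof. by apply/funext => n; rewrite /maxf cavgE. Qed.

End centered_averages.

Theorem theorem2 (R : realType) (f : int -> R) :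
  in_l1 f ->
  (totvar (maxf f) <= (2 + 146 / 315 : R)%:E * l1norm f)%E.
Proof.
move=> f_l1; rewrite maxfE.
apply: le_trans (totvar_weighted_max_le (@inv_odd_ge0 R)
  (@inv_odd_nonincreasing R) (@inv_odd_convex R) f_l1) _.
apply: lee_wpmul2r; first by apply: esum_ge0 => m _; rewrite lee_fin.
by rewrite lee_fin /inv_odd invr1 mulr1 lerDl divr_ge0.
Qed.
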